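(* Let $q\ge 2$ be an integer and $Q=\{0,\dots,q-1\}$. Let $x_1,x_2,\dots$ be independent, identically distributed $Q$-valued random variables with $\mathbb{P}[x_i=j]=p_j$ for $j\in Q$, and let $\widetilde{x}_1,\widetilde{x}_2,\dots$ be independent, identically distributed $Q$-valued random variables with $\mathbb{P}[\widetilde{x}_i=k]=\widetilde{p}_k$ for $k\in Q$. Put $X=\sum_{i=1}^\infty x_iq^{-i}$ and $\widetilde{X}=\sum_{i=1}^\infty\widetilde{x}_iq^{-i}$, with cumulative distribution functions $F(x)=\mathbb{P}[X\le x]$ and $\widetilde{F}(x)=\mathbb{P}[\widetilde{X}\le x]$, and let $\mu$ and $\widetilde{\mu}$ be the associated probability measures on $[0,1]$ (the laws of $X$ and $\widetilde X$). If there exists $t\in Q$ such that $p_t\neq\widetilde{p}_t$, then $\mu$ and $\widetilde{\mu}$ are mutually singular.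
   Context: The random variables $x_i$ and $\widetilde{x}_i$ model the outcomes of the $i$-th tosses of two (possibly unfair) $q$-sided dice with faces labelled $0,\dots,q-1$. Mutually singular means that there are disjoint Borel sets $S,\widetilde{S}\subseteq[0,1]$ with $\mu([0,1]\setminus S)=0$ and $\widetilde{\mu}([0,1]\setminus\widetilde{S})=0$. *)

(* Defs.v *)
From HB Require Import structures.
From mathcomp Require Import all_boot all_order all_algebra.
From mathcomp Require Import finmap.
From mathcomp Require Import all_classical all_reals all_analysis.
From mathcomp Require Import measurable_realfun.

Set Implicit Arguments.
Unset Strict Implicit.
Unset Printing Implicit Defensive.

Import Order.TTheory GRing.Theory Num.Theory.
Import numFieldNormedType.Exports.

Local Open Scope classical_set_scope.
Local Open Scope ring_scope.

(* Mutual independence of a family: the product rule over every finite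
   subfamily of indices and all measurable events. *)
Definition independent_RVs (d d' : measure_display) (T : measurableType d)
    (T' : measurableType d') (R : realType) (P : probability T R)
    (I : choiceType) (X : I -> {RV P >-> T'}) : Prop :=
  forall (J : {fset I}) (A : I -> set T'),
    (forall i, i \in J -> measurable (A i)) ->
    P (\bigcap_(i in [set` J]) (X i @^-1` A i)) =
    (\prod_(i <- J) P (X i @^-1` A i))%E.

(* Indices are shifted by one: [x i] is the digit of q^-(i+1). *)
Definition radix_value (R : realType) (q : nat) (x : nat -> nat) : R :=
  limn (series (fun i => (x i)%:R / q%:R ^+ i.+1 : R)).

Section radix_value_theory.
Context (R : realType) (q : nat) (x : nat -> nat)
  (xQ : forall i, (x i < q)%N).

Let u (n : nat) : R := \sum_(0 <= i < n) ((x i)%:R / q%:R ^+ i.+1).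

Let q_gt0 : (0 < q)%N. Proof. exact: leq_ltn_trans (xQ 0%N). Qed.

Let u_ge0 n : 0 <= u n.
Proof. by apply: sumr_ge0 => i _; rewrite divr_ge0// exprn_ge0. Qed.

Let u_le n : u n <= 1 - q%:R ^- n.
Proof.
elim: n => [|n IHn]; first by rewrite /u big_nil expr0 invr1 subrr.
rewrite /u big_nat_recr//= -/(u n).
have q0 : (0 : R) < q%:R by rewrite ltr0n.
have -> : 1 - q%:R ^- n.+1 = 1 - q%:R ^- n + (q%:R - 1) / q%:R ^+ n.+1 :> R.
  by rewrite mulrBl mul1r {2}exprS invfM mulrA divff ?gt_eqF// mul1r
    addrA subrK.
apply: lerD => //; rewrite ler_pM2r ?invr_gt0 ?exprn_gt0//.
by rewrite lerBrDr natr1 ler_nat.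
Qed.

Let u_le1 n : u n <= 1.
Proof.
by apply: (le_trans (u_le n)); rewrite gerBl invr_ge0 exprn_ge0.
Qed.

Lemma is_cvg_radix_value :
  cvgn (series (fun i => (x i)%:R / q%:R ^+ i.+1 : R)).
Proof.
rewrite -[series _]/u; apply: nondecreasing_is_cvgn.
  apply/nondecreasing_seqP => n; rewrite /u big_nat_recr//= lerDl.
  by rewrite divr_ge0// exprn_ge0.
by exists 1 => _ [n _ <-]; exact: u_le1.
Qed.

Lemma radix_value_itv : `[0, 1]%classic (radix_value R q x).
Proof.
rewrite /= in_itv/=; apply/andP; split.
  by apply: limr_ge; [exact: is_cvg_radix_value|exact: nearW].
by apply: limr_le; [exact: is_cvg_radix_value|exact: nearW].
Qed.

End radix_value_theory.

Section radix_RV.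
Context (d : measure_display) (T : measurableType d) (R : realType)
  (P : probability T R) (q : nat) (x : nat -> {RV P >-> nat}).

Definition radix_fun of (forall i w, (x i w < q)%N) : T -> R :=
  fun w => radix_value R q (fun i => x i w).

Variable xQ : forall i w, (x i w < q)%N.

Lemma measurable_radix_fun : measurable_fun [set: T] (radix_fun xQ).
Proof.
apply: (@measurable_fun_cvg _ _ _ _ (fun n w =>
    \sum_(0 <= i < n) ((x i w)%:R / q%:R ^+ i.+1))); last first.
  by move=> w _; apply: is_cvg_radix_value.
move=> n; apply: measurable_sum => i.
have mf : measurable_fun [set: nat]
    (fun j : nat => j%:R / q%:R ^+ i.+1 : R) by [].
exact: measurableT_comp mf (measurable_funPT (x i)).
Qed.

HB.instance Definition _ :=
  isMeasurableFun.Build _ _ _ _ (radix_fun xQ) measurable_radix_fun.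

Definition radix_RV : {RV P >-> R} := radix_fun xQ.

Lemma radix_RV_law_itv : distribution P radix_RV `[0, 1]%classic = 1%E.
Proof.
rewrite /distribution /pushforward (_ : _ @^-1` _ = setT) ?probability_setT//.
by apply/seteqP; split => // w _; exact: radix_value_itv.
Qed.

End radix_RV.

(* The ambient space is [0, 1]: both carriers lie in it and complements are
   taken relative to it. *)
Definition mutually_singular_itv01 (R : realType)
    (mu nu : probability R R) : Prop :=
  exists S S' : set R,
    [/\ measurable S, measurable S', S `<=` `[0, 1] & S' `<=` `[0, 1]] /\
    [/\ S `&` S' = set0, mu (`[0, 1] `\` S) = 0%E &
        nu (`[0, 1] `\` S') = 0%E].

(* Main.v *)
Require Import Defs.
From mathcomp Require Import all_boot all_order all_algebra.
From mathcomp Require Import finmap ring.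
From mathcomp Require Import all_classical all_reals all_analysis.
From mathcomp Require Import measurable_realfun.

Set Implicit Arguments.
Unset Strict Implicit.
Unset Printing Implicit Defensive.

Import Order.TTheory GRing.Theory Num.Theory.
Import numFieldNormedType.Exports.

Local Open Scope classical_set_scope.
Local Open Scope ring_scope.

(** The two laws are separated by Kakutani's affinity argument.  Put
    rho := \sum_j sqrt (p_j p'_j).  As p and p' are distinct probability
    vectors, 1 - rho is half of \sum_j (sqrt p_j - sqrt p'_j)^2, so rho < 1
    ([affinity_lt1]).  Let [A_n] be the set of words of [n] digits that are at
    least as likely under p as under p'.  Where one of two nonnegative numbers
    is at most the other, it is at most their geometric mean; summing over
    words, the affinity of the two [n]-fold product distributions is rho^n, so
    the first [n] digits lie outside [A_n] with p-probability at most rho^n,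
    and in [A_n] with p'-probability at most rho^n ([prod_le_affinity]).
    These bounds are summable.  By Borel-Cantelli the set where the first [n]
    digits lie outside [A_n] for infinitely many [n] is null for one law, and
    its complement is null for the other
    ([mutually_singular_itv01_geometric]).

    The separating set has to be a Borel set of reals, whereas the digits of a
    real are not unique.  Digits are read off by iterating the expanding map
    y |-> q y - digit y, with the leading digit capped at q - 1 so that 1 reads
    as (q-1)(q-1)(q-1)... .  This recovers the digit sequence of every radix
    sum except when some digit different from q - 1 is followed by digits
    q - 1 only ([radix_digits_value]).  With s := p_(q-1), such a pattern at a
    given place has probability at most (1 - s) s^n for every n, hence
    probability 0, whether s = 1 or s < 1 ([max_tail_prob]).  Because of the
    cap the degenerate laws, concentrated at 0 or 1, need no separate
    treatment. *)

(** * Reading the digits of a real number *)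

Section radix_digits.
Context (R : realType) (q : nat).

(** The cap [q.-1] only matters on [0, 1] at [y = 1], which then has all its
    digits equal to [q.-1] instead of the spurious leading digit [q]. *)
Definition radix_digit (y : R) : nat := minn (Num.truncn (q%:R * y)) q.-1.

Definition radix_shift (y : R) : R := q%:R * y - (radix_digit y)%:R.

Definition radix_digits (i : nat) (y : R) : nat :=
  radix_digit (iter i radix_shift y).

Lemma ltn_radix_digits i y : (0 < q)%N -> (radix_digits i y < q)%N.
Proof.
by move=> q_gt0; rewrite /radix_digits /radix_digit gtn_min ltn_predL q_gt0
  orbT.
Qed.

Lemma radix_value_recl (x : nat -> nat) : (forall i, x i < q)%N ->
  q%:R * radix_value R q x = (x 0)%:R + radix_value R q (fun i => x i.+1).
Proof.
move=> xQ.
have q0 : q%:R != 0 :> R by rewrite pnatr_eq0 -lt0n (leq_ltn_trans _ (xQ 0)).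
pose u := series (fun i => (x i)%:R / q%:R ^+ i.+1 : R).
pose v := series (fun i => (x i.+1)%:R / q%:R ^+ i.+1 : R).
have uv n : q%:R * u n.+1 = (x 0)%:R + v n.
  rewrite /u /v /series/= big_nat_recl// mulrDr expr1 mulrC divfK//.
  congr (_ + _).
  rewrite mulr_sumr; apply: eq_bigr => i _.
  by rewrite [in LHS]exprS invfM mulrCA mulVKf.
have cu : u @ \oo --> radix_value R q x by exact: is_cvg_radix_value.
have cv : v @ \oo --> radix_value R q (fun i => x i.+1).
  exact: (@is_cvg_radix_value R q (fun i => x i.+1)).
have cu' : (fun n => q%:R * u n.+1) @ \oo --> q%:R * radix_value R q x.
  by apply: cvgM; [exact: cvg_cst|rewrite (cvg_shiftS u)].
have cv' : (fun n => (x 0)%:R + v n) @ \oo -->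
    (x 0)%:R + radix_value R q (fun i => x i.+1).
  by apply: cvgD => //; exact: cvg_cst.
rewrite (_ : (fun n => _) = fun n => (x 0)%:R + v n) in cu'; last exact/funext.
exact: (cvg_unique (@Rhausdorff R) cu' cv').
Qed.

(** From q X = x_0 + X' with x_0 <= q - 1 and X' <= 1, the value X = 1 forces
    equality in both bounds, and X' = 1 allows to continue with the shifted
    sequence. *)
Lemma radix_value_eq1 (x : nat -> nat) : (forall i, x i < q)%N ->
  radix_value R q x = 1 -> forall i, x i = q.-1.
Proof.
move=> + + i; elim: i x => [|i IH] x xQ x1.
all: have q_gt0 : (0 < q)%N by exact: leq_ltn_trans (xQ 0).
all: have xSQ j : (x j.+1 < q)%N by [].
all: have /andP[_ y1] : 0 <= radix_value R q (fun i => x i.+1) <= 1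
  by have := radix_value_itv R xSQ; rewrite /= in_itv.
all: have := radix_value_recl xQ; rewrite x1 mulr1 => qE.
all: have x0 : (q.-1 <= x 0)%N
  by rewrite -ltnS prednK// -(ler_nat R) -natr1 qE lerD2l.
all: have {}x0 : x 0 = q.-1
  by apply/eqP; rewrite eqn_leq x0 andbT -ltnS prednK.
  exact: x0.
apply: (IH (fun i => x i.+1)) => //.
apply: (@addrI _ (x 0)%:R); rewrite -qE x0 natr1 prednK//.
Qed.

(** Since q X = x_0 + X' with 0 <= X' <= 1, truncation returns x_0 unless
    X' = 1; in that case all later digits are q - 1, and the cap repairs the
    carry provided that x_0 = q - 1 too. *)
Lemma radix_digit_value (x : nat -> nat) : (forall i, x i < q)%N ->
    ((forall k, x k.+1 = q.-1) -> x 0 = q.-1) ->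
  radix_digit (radix_value R q x) = x 0.
Proof.
move=> xQ x_tail; rewrite /radix_digit radix_value_recl//.
have q_gt0 : (0 < q)%N by exact: leq_ltn_trans (xQ 0).
have xSQ j : (x j.+1 < q)%N by [].
have /andP[y0 y_le1] : 0 <= radix_value R q (fun i => x i.+1) <= 1.
  by have := radix_value_itv R xSQ; rewrite /= in_itv.
have [y1|y_neq1] := eqVneq (radix_value R q (fun i => x i.+1)) 1; last first.
  have y_lt1 : radix_value R q (fun i => x i.+1) < 1.
    by rewrite lt_neqAle y_neq1.
  rewrite (@truncn_def _ _ (x 0)) ?lerDl ?y0 -?natr1 ?ltrD2l//.
  by apply/minn_idPl; rewrite -ltnS prednK.
rewrite y1 x_tail; last exact: (@radix_value_eq1 (fun i => x i.+1)).
by rewrite natr1 natrK prednK//; apply/minn_idPr/leq_pred.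
Qed.

Lemma radix_digits_value (x : nat -> nat) : (forall i, x i < q)%N ->
    (forall j, (forall k, x (j + k.+1)%N = q.-1) -> x j = q.-1) ->
  forall i, radix_digits i (radix_value R q x) = x i.
Proof.
move=> + + i; elim: i x => [|i IH] x xQ x_tail.
  by rewrite /radix_digits/= radix_digit_value//; exact: (x_tail 0).
have <- := IH (fun i => x i.+1) (fun i => xQ i.+1) (fun j => x_tail j.+1).
rewrite /radix_digits iterSr; congr (radix_digit (iter _ _ _)).
rewrite /radix_shift radix_digit_value//; last exact: (x_tail 0).
by rewrite radix_value_recl// addrC addKr.
Qed.

(** A digit being at least [n] is a half-line of reals, or the empty set when
    [n] exceeds the cap; the level sets are differences of two of these. *)
Lemma measurable_radix_digit : measurable_fun [set: R] radix_digit.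
Proof.
have mqM : measurable_fun [set: R] (fun y => q%:R * y).
  exact: measurable_funM.
have mge n : measurable [set y | (n <= radix_digit y)%N].
  have [nq|nq] := leqP n q.-1; last first.
    rewrite (_ : mkset _ = set0)//; apply/seteqP; split => // y /=.
    by rewrite leq_min [(n <= q.-1)%N]leqNgt nq andbF.
  case: n nq => [|n] nq; first by rewrite (_ : mkset _ = setT)//; apply/seteqP.
  rewrite (_ : mkset _ = (fun y => q%:R * y) @^-1` `[n.+1%:R, +oo[%classic).
    rewrite -[X in measurable X]setTI.
    exact: mqM.
  apply/seteqP; split => y /=;
    by rewrite leq_min nq andbT truncn_gt_nat in_itv/= andbT.
move=> _ Y _; rewrite setTI.
rewrite (_ : _ @^-1` _ = \bigcup_(n in Y)
  ([set y | (n <= radix_digit y)%N] `\` [set y | (n.+1 <= radix_digit y)%N])).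
  by apply: bigcup_measurable => n _; exact: measurableD.
apply/seteqP; split => [y Yy|y [n Yn []]] /=.
  by exists (radix_digit y) => //; split => //=; apply/negP; rewrite ltnn.
move=> ny /negP; rewrite -leqNgt => yn.
by rewrite /preimage/= (_ : radix_digit y = n)//; apply/eqP; rewrite eqn_leq yn.
Qed.

Lemma measurable_radix_digits i : measurable_fun [set: R] (radix_digits i).
Proof.
apply: measurableT_comp; first exact: measurable_radix_digit.
elim: i => [|i IH]; first exact: measurable_id.
apply: (@measurableT_comp _ _ _ _ _ _ radix_shift) => //.
apply: measurable_funB; first by apply: measurable_funM.
have mnat : measurable_fun [set: nat] (fun n : nat => n%:R : R) by [].
exact: (measurableT_comp mnat measurable_radix_digit).
Qed.

End radix_digits.

(** * Singularity from geometrically small separating sets *)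

Lemma lim_sup_set_geometric_eq0 d (T : measurableType d) (R : realType)
    (mu : {measure set T -> \bar R}) (F : (set T)^nat) (r : R) : 0 <= r < 1 ->
    (forall n, measurable (F n)) -> (forall n, (mu (F n) <= (r ^+ n)%:E)%E) ->
  mu (lim_sup_set F) = 0%E.
Proof.
move=> /andP[r0 r1] mF Fr; apply: lim_sup_set_cvg0 => //.
apply: (@le_lt_trans _ _ (\sum_(0 <= n <oo) (r ^+ n)%:E)%E).
  by apply: lee_nneseries => // n _; exact: Fr.
have cr : cvgn (series (geometric 1 r)).
  by apply: is_cvg_geometric_series; rewrite ger0_norm.
rewrite (_ : (fun n => _) = EFin \o series (geometric 1 r)).
  by rewrite EFin_lim ?ltry.
apply/funext => n /=; rewrite /series/= -sumEFin.
by apply: eq_bigr => i _; rewrite mul1r.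
Qed.

(** The limit superior of the sets [~` B n] is [mu]-null by Borel-Cantelli.  A
    point outside it belongs to [B n] for all large [n], hence to the limit
    superior of [B], which is [nu]-null by Borel-Cantelli again. *)
Lemma mutually_singular_itv01_geometric (R : realType)
    (mu nu : probability R R) (B : (set R)^nat) (r : R) : 0 <= r < 1 ->
    (forall n, measurable (B n)) ->
    (forall n, (mu (~` B n) <= (r ^+ n)%:E)%E) ->
    (forall n, (nu (B n) <= (r ^+ n)%:E)%E) ->
  mutually_singular_itv01 mu nu.
Proof.
move=> r01 mB muB nuB.
have mBC n : measurable (~` B n) by exact: measurableC.
have mls (F : (set R)^nat) : (forall n, measurable (F n)) ->
    measurable (lim_sup_set F).
  move=> mF; apply: bigcapT_measurable => n.
  by apply: bigcup_measurable => k _; exact: mF.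
pose N := lim_sup_set (fun n => ~` B n).
have mN : measurable N by exact: mls.
exists (`[0, 1] `\` N), (`[0, 1] `&` N); split; split.
- exact: measurableD.
- exact: measurableI.
- exact: subIsetl.
- exact: subIsetl.
- by apply/seteqP; split => // y [[_ nNy] [_ Ny]].
- apply: (@subset_measure0 _ _ _ _ _ N) => //.
  + by apply: measurableD => //; exact: measurableD.
  + by move=> y [y01 /not_andP[//|/contrapT]].
  + exact: lim_sup_set_geometric_eq0 muB.
- apply: (@subset_measure0 _ _ _ _ _ (lim_sup_set B)) => //.
  + by apply: measurableD => //; exact: measurableI.
  + exact: mls.
  + move=> y [y01 /not_andP[//|nNy]] n _.
    apply: contrapT => nBy; apply: nNy => m _.
    exists (maxn m n); first exact: leq_maxl.
    by move=> By; apply: nBy; exists (maxn m n) => //; exact: leq_maxr.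
  + exact: lim_sup_set_geometric_eq0 nuB.
Qed.

(** * The affinity of two probability vectors *)

(** Twice the defect from 1 is \sum_i (sqrt p_i - sqrt p'_i)^2, which is
    positive as soon as one summand is. *)
Lemma affinity_lt1 (R : rcfType) (I : finType) (p p' : I -> R) :
    (forall i, 0 <= p i) -> (forall i, 0 <= p' i) ->
    \sum_i p i = 1 -> \sum_i p' i = 1 -> (exists i, p i <> p' i) ->
  0 <= \sum_i Num.sqrt (p i * p' i) < 1.
Proof.
move=> p0 p'0 p1 p'1 [t pt]; rewrite sumr_ge0 => [|i _]; last exact: sqrtr_ge0.
rewrite -subr_gt0 -(pmulr_rgt0 _ (ltr0n R 2)).
have -> : 2%:R * (1 - \sum_i Num.sqrt (p i * p' i)) =
    \sum_i (Num.sqrt (p i) - Num.sqrt (p' i)) ^+ 2.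
  transitivity (\sum_i p i + \sum_i p' i - 2%:R * \sum_i Num.sqrt (p i * p' i)).
    by rewrite p1 p'1; ring.
  rewrite mulr_sumr -big_split -sumrB; apply: eq_bigr => i _.
  by rewrite sqrrB !sqr_sqrtr// sqrtrM// mulr_natl addrAC.
rewrite (bigD1 t)//= ltr_pwDl//; last by apply: sumr_ge0 => i _; exact: sqr_ge0.
rewrite lt_neqAle sqr_ge0 andbT eq_sym sqrf_eq0 subr_eq0.
by apply/eqP => /eqP; rewrite eqr_sqrt// => /eqP.
Qed.

Lemma sqrtr_prod (R : rcfType) (I : finType) (a : I -> R) :
  (forall i, 0 <= a i) -> Num.sqrt (\prod_i a i) = \prod_i Num.sqrt (a i).
Proof.
move=> a0; suff [] : 0 <= \prod_i a i /\
  Num.sqrt (\prod_i a i) = \prod_i Num.sqrt (a i) by [].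
elim/big_ind2 : _ => [|x x' y y' [x0 <-] [y0 <-]|i _]; rewrite ?sqrtr1//.
by rewrite sqrtrM// mulr_ge0.
Qed.

(** On [A] the product for [p] is at most the geometric mean of the two
    products.  Summed over all words, the geometric means give a power of the
    affinity, by distributing the product over the sum. *)
Lemma prod_le_affinity (R : rcfType) (I J : finType) (p p' : J -> R)
    (A : {pred {ffun I -> J}}) :
    (forall j, 0 <= p j) -> (forall j, 0 <= p' j) ->
    (forall v, v \in A -> \prod_i p (v i) <= \prod_i p' (v i)) ->
  \sum_(v in A) \prod_i p (v i) <= (\sum_j Num.sqrt (p j * p' j)) ^+ #|I|.
Proof.
move=> p0 p'0 pp'.
rewrite -prodr_const bigA_distr_bigA/= [leRHS](bigID (mem A))/=.
rewrite -[leLHS]addr0 lerD//; last first.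
  by apply: sumr_ge0 => v _; apply: prodr_ge0 => i _; exact: sqrtr_ge0.
apply: ler_sum => v Av; rewrite -sqrtr_prod; last by move=> i; rewrite mulr_ge0.
have P0 : 0 <= \prod_i p (v i) by apply: prodr_ge0.
rewrite big_split/= -[leLHS]ger0_norm// -sqrtr_sqr ler_wsqrtr//.
by rewrite expr2 ler_wpM2l// pp'.
Qed.

(** * A vanishing bound and finite subadditivity *)

(** For [s < 1] the bound tends to 0; for [s = 1] it is 0 already. *)
Lemma geometric_tail_le0 (R : realType) (s a : R) : 0 <= s <= 1 ->
  (forall n, a <= (1 - s) * s ^+ n) -> a <= 0.
Proof.
move=> /andP[s0]; rewrite le_eqVlt => /predU1P[-> /(_ 0)|s1 aS].
  by rewrite subrr mul0r.
have cs : geometric (1 - s) s @ \oo --> (0 : R).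
  by apply: cvg_geometric; rewrite ger0_norm.
have <- := cvg_lim (@Rhausdorff R) cs.
by apply: limr_ge; [exact: cvgP cs|exact: nearW].
Qed.

Lemma le_measure_bigsetU d (T : measurableType d) (R : realType)
    (mu : {measure set T -> \bar R}) (I : finType) (A : {pred I})
    (F : I -> set T) :
  (forall i, measurable (F i)) ->
  (mu (\big[setU/set0]_(i in A) F i) <= \sum_(i in A) mu (F i))%E.
Proof.
move=> mF; suff [] : measurable (\big[setU/set0]_(i in A) F i) /\
  (mu (\big[setU/set0]_(i in A) F i) <= \sum_(i in A) mu (F i))%E by [].
elim/big_ind2 : _ => [|X x Y y [mX Xx] [mY Yy]|//].
  by rewrite measure0.
by split; [exact: measurableU|exact: le_trans (measureU2 _ _ _) (leeD _ _)].
Qed.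

(** * Events determined by the first digits *)

Section has_word.
Context (q n : nat).

(** The digit process [z] lives on an arbitrary type, so that the same event can
    be formed for the random digits and for the digits read off from a real. *)
Definition has_word (U : Type) (z : nat -> U -> nat)
    (A : {pred {ffun 'I_n -> 'I_q}}) : set U :=
  [set w | exists2 v, v \in A & forall i : 'I_n, z i w = v i].

Lemma has_wordE U (z : nat -> U -> nat) A :
  has_word z A =
  \big[setU/set0]_(v in A) [set w | forall i : 'I_n, z i w = v i].
Proof.
by rewrite -bigcup_pred; apply/seteqP; split => w [v vA zv]; exists v.
Qed.

Lemma setC_has_word U (z : nat -> U -> nat) A : (forall i w, z i w < q)%N ->
  ~` has_word z A = has_word z [predC A].
Proof.
move=> zq; apply/seteqP; split => w; last first.
  move=> [v vA zv] [v' v'A zv']; move: vA; rewrite inE /=.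
  suff -> : v = v' by rewrite v'A.
  by apply/ffunP => i; apply: val_inj; rewrite /= -zv -zv'.
move=> nA; exists [ffun i : 'I_n => Ordinal (zq i w)].
  by rewrite inE; apply/negP => vA; apply: nA; eexists; [exact: vA|]
    => i; rewrite ffunE.
by move=> i; rewrite ffunE.
Qed.

Lemma measurable_word d (T : measurableType d) (z : nat -> T -> nat)
    (v : {ffun 'I_n -> 'I_q}) :
  (forall i, measurable_fun [set: T] (z i)) ->
  measurable [set w | forall i : 'I_n, z i w = v i].
Proof.
move=> mz; rewrite (_ : mkset _ =
    \bigcap_(i in [set: 'I_n]) (z i @^-1` [set (v i : nat)])).
  apply: fin_bigcap_measurable; first exact: finite_finset.
  by move=> i _; rewrite -[X in measurable X]setTI; exact: mz.
by apply/seteqP; split => w /= zv i; [move=> _|]; exact: zv.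
Qed.

Lemma measurable_has_word d (T : measurableType d) (z : nat -> T -> nat) A :
  (forall i, measurable_fun [set: T] (z i)) -> measurable (has_word z A).
Proof.
move=> mz; rewrite has_wordE; apply: bigsetU_measurable => v _.
exact: measurable_word.
Qed.

End has_word.

(** * Words and tails of independent digits *)

Section digits.
Context (d : measure_display) (T : measurableType d) (R : realType)
  (P : probability T R).

Lemma independent_RVs_seq (x : nat -> {RV P >-> nat}) (s : seq nat)
    (A : nat -> set nat) : independent_RVs x -> uniq s ->
  P (\bigcap_(i in [set` s]) (x i @^-1` A i)) =
  (\prod_(i <- s) P (x i @^-1` A i))%E.
Proof.
move=> x_indep us.
have := x_indep [fset i in s]%fset A (fun _ _ => I).
rewrite (perm_big s)/=; last first.
  apply: uniq_perm => //; first exact: fset_uniq.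
  by move=> i; rewrite !inE.
move=> <-; congr (P _).
by apply/seteqP; split => w xA i /= si; apply: xA; move: si; rewrite /= !inE.
Qed.

Context (x : nat -> {RV P >-> nat}) (q : nat) (p : 'I_q -> R)
  (xQ : forall i w, (x i w < q)%N) (x_indep : independent_RVs x)
  (x_dist : forall (i : nat) (j : 'I_q),
    P [set w | x i w = j :> nat] = (p j)%:E).

Lemma digit_prob_ge0 j : 0 <= p j.
Proof. by rewrite -lee_fin -(x_dist 0) measure_ge0. Qed.

Lemma sum_digit_prob : \sum_j p j = 1.
Proof.
apply: EFin_inj; rewrite -sumEFin -(@probability_setT _ _ _ P).
under eq_bigr do rewrite -(x_dist 0).
rewrite -(@measure_bigsetU_ord _ _ _ P _ predT
  (fun j : 'I_q => [set w | x 0 w = j :> nat])).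
- congr (P _); apply/seteqP; split => // w _.
  rewrite -(bigcup_pred predT (fun j : 'I_q => [set w | x 0 w = j :> nat])).
  by exists (Ordinal (xQ 0 w)).
- by move=> j; exact: (measurable_funPTI (x 0) (Y := [set (j : nat)])).
- by move=> i j _ _ [w [/= -> /val_inj]].
Qed.

(** The product rule applied to the first [n] indices. *)
Lemma word_prob n (v : {ffun 'I_n -> 'I_q}) :
  P [set w | forall i : 'I_n, x i w = v i] = (\prod_i p (v i))%:E.
Proof.
(* [insub] extends the constraint on indices below [n] to all indices. *)
pose A i : set nat := if insub i is Some j then [set (v j : nat)] else setT.
have AE (i : 'I_n) : A i = [set (v i : nat)] by rewrite /A valK.
rewrite -prodEFin; under eq_bigr => i _ do rewrite -(x_dist i).
transitivity (\prod_(i < n) P (x i @^-1` A i))%E; last first.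
  by apply: eq_bigr => i _; rewrite AE.
rewrite -(big_mkord predT (fun i => P (x i @^-1` A i))).
rewrite -independent_RVs_seq ?iota_uniq//; congr (P _).
apply/seteqP; split => w xv.
  move=> i /=; rewrite mem_index_iota/= => i_n.
  by rewrite (AE (Ordinal i_n)) /= (xv (Ordinal i_n)).
move=> i; have := xv i; rewrite /= mem_index_iota ltn_ord AE; exact.
Qed.

Lemma has_word_prob_le n (A : {pred {ffun 'I_n -> 'I_q}}) :
  (P (has_word x A) <= (\sum_(v in A) \prod_i p (v i))%:E)%E.
Proof.
rewrite has_wordE -sumEFin; apply: le_trans.
  apply: le_measure_bigsetU => v.
  apply: (measurable_word (z := fun i => x i : T -> nat)) => i.
  exact: measurable_funPT.
by apply: lee_sum => v _; rewrite -(word_prob v).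
Qed.

Definition max_tail_from j : set T :=
  [set w | x j w <> q.-1 /\ forall k, x (j + k.+1)%N w = q.-1].

(** The outcomes whose digit sequence is not the one read off by
    [radix_digits] from their sum. *)
Definition max_tail : set T := \bigcup_j max_tail_from j.

Lemma measurable_max_tail_from j : measurable (max_tail_from j).
Proof.
rewrite (_ : max_tail_from j = (x j @^-1` [set~ q.-1]) `&`
    \bigcap_k (x (j + k.+1)%N @^-1` [set q.-1])).
  apply: measurableI; first exact: measurable_funPTI.
  by apply: bigcapT_measurable => k; exact: measurable_funPTI.
apply/seteqP; split => w [/= xj xk]; split => // k; last exact: xk.
by move=> _; exact: xk.
Qed.

Lemma measurable_max_tail : measurable max_tail.
Proof. exact: bigcupT_measurable measurable_max_tail_from. Qed.

(** For every [n], the event at place [j] fixes digit [j] to differ from q - 1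
    and the next [n] digits to be q - 1, so its probability is at most
    (1 - s) s^n with [s] the probability of the digit q - 1. *)
Lemma max_tail_prob : P max_tail = 0%E.
Proof.
(* A sample point is needed to know that q > 0, so that q - 1 is a digit. *)
have [w0|T0] := pselect ([set: T] !=set0); last first.
  rewrite (_ : max_tail = set0) ?measure0//.
  by apply/seteqP; split => // w _; apply: T0; exists w.
have q_gt0 : (0 < q)%N by case: w0 => w _; exact: leq_ltn_trans (xQ 0 w).
have lastq : (q.-1 < q)%N by rewrite ltn_predL.
pose s := p (Ordinal lastq).
have xs i : P (x i @^-1` [set q.-1]) = s%:E.
  exact: (x_dist i (Ordinal lastq)).
apply: measure_negligible; first exact: measurable_max_tail.
apply: negligible_bigcup => j.
have mN := measurable_max_tail_from j; set N := max_tail_from j.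
exists N; split => //.
have s01 : 0 <= s <= 1.
  rewrite digit_prob_ge0 -lee_fin -(xs 0); apply: probability_le1.
  exact: measurable_funPTI.
have PN : P N \is a fin_num by exact: fin_num_measure.
suff PN_le0 : (P N <= 0)%E by apply/eqP; rewrite eq_le measure_ge0 andbT.
rewrite -(fineK PN) lee_fin.
apply: (geometric_tail_le0 s01) => n; rewrite -lee_fin fineK//.
pose A i := if i == j then [set~ q.-1] else [set q.-1].
have us : uniq (j :: iota j.+1 n) by rewrite /= mem_iota ltnn iota_uniq.
pose W := \bigcap_(i in [set` j :: iota j.+1 n]) (x i @^-1` A i).
apply: (@le_trans _ _ (P W)).
  apply: le_measure; rewrite ?inE//.
    apply: fin_bigcap_measurable; first exact: finite_seq.
    by move=> i _; exact: measurable_funPTI.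
  move=> w [xj xk] i; rewrite /= inE mem_iota /A.
  case: eqVneq => [-> //|_ /= /andP[ji _]].
  by have := xk (i - j.+1)%N; rewrite addnS -addSn subnKC.
rewrite independent_RVs_seq// big_cons {1}/A eqxx.
have -> : P (x j @^-1` [set~ q.-1]) = (1 - s)%:E.
  rewrite -[_ @^-1` _]/(~` (x j @^-1` [set q.-1])) probability_setC ?xs//.
  exact: measurable_funPTI.
rewrite (eq_big_seq (fun=> s%:E)); last first.
  by move=> i; rewrite mem_iota /A => /andP[ji _]; rewrite gtn_eqF.
by rewrite prodEFin big_const_seq count_predT size_iota iter_mulr_1.
Qed.

Lemma radix_digits_RV w : ~ max_tail w ->
  forall i, radix_digits q i (radix_RV xQ w) = x i w.
Proof.
move=> nw; apply: radix_digits_value => // j xj.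
by apply: contrapT => xjq; apply: nw; exists j.
Qed.

(** Up to the null event [max_tail], the digits of the random sum are the random
    digits themselves. *)
Lemma distribution_has_word_le n (A : {pred {ffun 'I_n -> 'I_q}}) :
  (distribution P (radix_RV xQ) (has_word (@radix_digits R q) A) <=
   (\sum_(v in A) \prod_i p (v i))%:E)%E.
Proof.
apply: le_trans (has_word_prob_le A).
have mA : measurable (has_word x A).
  by apply: measurable_has_word => i; exact: measurable_funPT.
rewrite -[leLHS]/(P (radix_RV xQ @^-1` has_word (@radix_digits R q) A)).
apply: (@le_trans _ _ (P (max_tail `|` has_word x A))).
  apply: le_measure; rewrite ?inE.
  - apply: (measurable_funPTI (radix_RV xQ)); apply: measurable_has_word => i.
    exact: measurable_radix_digits.
  - by apply: measurableU => //; exact: measurable_max_tail.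
  - move=> w [v vA wv]; have [wt|wt] := pselect (max_tail w); first by left.
    by right; exists v => // i; rewrite -wv radix_digits_RV.
apply: le_trans (measureU2 _ measurable_max_tail mA) _.
by rewrite [X in (X + _)%E]max_tail_prob add0e.
Qed.

End digits.

Theorem theorem3p3 (R : realType) (q : nat) (q_ge2 : (2 <= q)%N)
    (d d' : measure_display) (T : measurableType d) (T' : measurableType d')
    (P : probability T R) (P' : probability T' R)
    (x : nat -> {RV P >-> nat}) (x' : nat -> {RV P' >-> nat})
    (xQ : forall i w, (x i w < q)%N) (x'Q : forall i w, (x' i w < q)%N)
    (p p' : 'I_q -> R)
    (x_indep : independent_RVs x)
    (x_dist : forall (i : nat) (j : 'I_q), P [set w | x i w = j :> nat] = (p j)%:E)
    (x'_indep : independent_RVs x')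
    (x'_dist : forall (i : nat) (k : 'I_q),
      P' [set w | x' i w = k :> nat] = (p' k)%:E)
    (p_neq : exists t : 'I_q, p t <> p' t) :
  mutually_singular_itv01
    (distribution P (radix_RV xQ)) (distribution P' (radix_RV x'Q)).
Proof.
have p_ge0 := digit_prob_ge0 x_dist; have p'_ge0 := digit_prob_ge0 x'_dist.
pose rho := \sum_j Num.sqrt (p j * p' j).
have rho01 : 0 <= rho < 1.
  exact: affinity_lt1 (sum_digit_prob xQ x_dist) (sum_digit_prob x'Q x'_dist) _.
pose A n := [pred v : {ffun 'I_n -> 'I_q} |
  \prod_i p' (v i) <= \prod_i p (v i)].
pose B n := has_word (@radix_digits R q) (A n).
apply: (mutually_singular_itv01_geometric rho01 (B := B)) => n.
- by apply: measurable_has_word => i; exact: measurable_radix_digits.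
- rewrite setC_has_word; last first.
    by move=> i y; apply: ltn_radix_digits; exact: ltnW.
  apply: le_trans (distribution_has_word_le xQ x_indep x_dist _) _.
  rewrite lee_fin -[n in leRHS]card_ord; apply: prod_le_affinity => // v.
  by rewrite !inE -ltNge => /ltW.
- apply: le_trans (distribution_has_word_le x'Q x'_indep x'_dist _) _.
  rewrite lee_fin -[n in leRHS]card_ord.
  have -> : rho = \sum_j Num.sqrt (p' j * p j).
    by apply: eq_bigr => j _; rewrite mulrC.
  by apply: prod_le_affinity => // v; rewrite inE.
Qed.
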